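(* Let $(A,\mathbf{B},\delta)$ be an asymmetric (i.e. not symmetric) $C$-algebra of rank $3$ arising from an Allen matrix $s$. Then $s$ is the character table of the cyclic group of order $3$.
   Context: Fourier and Allen matrices: rows and columns of $r\times r$ matrices are indexed by $0,1,\dots,r-1$. A Fourier matrix of rank $r$ is a complex $r\times r$ matrix $S$ that is unitary and symmetric, has $S_{i0}>0$ for all $i$, and satisfies $N_{ijk}=\sum_l S_{li}S_{lj}\overline{S_{lk}}\,S_{l0}^{-1}\in\mathbb{Z}$ for all $i,j,k$. The associated Allen matrix is $s=[s_{ij}]$ with $s_{ij}=S_{ij}/S_{i0}$. $C$-algebra arising from $s$: put $P=[p_{ij}]$ with $p_{ij}=s_{ij}s_{0j}$, let $b_j\in\mathbb{C}^r$ be the $j$-th column of $P$, $\mathbf{B}=\{b_0,\dots,b_{r-1}\}$, and let $A$ be the $\mathbb{C}$-span of $\mathbf{B}$ with componentwise multiplication, whose identity is $b_0$. The involution $*$ on $A$ is entrywise complex conjugation, and it maps $\mathbf{B}$ to itself, $b_j^*=b_{j^*}$. The degree map $\delta:A\to\mathbb{C}$ is the algebra homomorphism giving the $0$-th coordinate, so $\delta(b_j)=p_{0j}=s_{0j}^2>0$. The triple $(A,\mathbf{B},\delta)$ is the $C$-algebra arising from the Allen matrix $s$, of rank $r$. The algebra is called symmetric if $b_{i^*}=b_i$ for all $i$. The character table of the cyclic group of order $3$ is $\begin{bmatrix}1&1&1\\1&\zeta_3&\zeta_3^2\\1&\zeta_3^2&\zeta_3\end{bmatrix}$, with $\zeta_3$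 a primitive cube root of unity. *)

(* Defs.v *)
From mathcomp Require Import all_boot all_order all_algebra.
From mathcomp Require Import reals complex.

Set Implicit Arguments.
Unset Strict Implicit.
Unset Printing Implicit Defensive.

Import GRing.Theory Num.Theory.
Local Open Scope ring_scope.

Section Fourier.
Variables (C : numClosedFieldType) (n : nat).
Implicit Types S s : 'M[C]_n.+1.

(* Rank is [n.+1], so that the index 0 exists. *)
Definition fusion_coef S (i j k : 'I_n.+1) : C :=
  \sum_l S l i * S l j * (S l k)^* * (S l 0)^-1.

(* In a [numClosedFieldType], [0 < z] means that z is real and positive. *)
Definition fourier_matrix S : Prop :=
  [/\ S \is unitarymx,
      S^T = S,
      forall i, 0 < S i 0
    & forall i j k, exists m : int, fusion_coef S i j k = m%:~R].

Definition allen_of S : 'M[C]_n.+1 := \matrix_(i, j) (S i j / S i 0).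

Definition allen_matrix s : Prop :=
  exists2 S, fourier_matrix S & s = allen_of S.

Definition first_eigenmatrix s : 'M[C]_n.+1 := \matrix_(i, j) (s i j * s 0 j).

End Fourier.

(* The data of a C-algebra (A, B, delta) of rank r realized inside C^r; the
   product and involution of A are given as operations on all of C^r. *)
Record calg_data (C : numClosedFieldType) (r : nat) := CAlgebra {
  calg_space : {vspace 'cV[C]_r};
  calg_mul : 'cV[C]_r -> 'cV[C]_r -> 'cV[C]_r;
  calg_star : 'cV[C]_r -> 'cV[C]_r;
  calg_basis : 'I_r -> 'cV[C]_r;
  calg_degree : subvs_of calg_space -> C
}.

Definition allen_calgebra (C : numClosedFieldType) (n : nat)
    (s : 'M[C]_n.+1) : calg_data C n.+1 :=
  let b j := col j (first_eigenmatrix s) in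
  @CAlgebra C n.+1 <<[seq b j | j : 'I_n.+1]>>%VS
    (fun u v => map2_mx *%R u v) (map_mx Num.conj) b (fun a => vsval a 0 0).

(* b_{i^*} is by definition (b_i)^*, so b_{i^*} = b_i reads (b_i)^* = b_i. *)
Definition calg_symmetric (C : numClosedFieldType) (r : nat)
    (X : calg_data C r) : Prop :=
  forall i, calg_star X (calg_basis X i) = calg_basis X i.

Definition cyclic3_table (C : numClosedFieldType) (zeta : C) : 'M[C]_3 :=
  \matrix_(i, j) nth 0 (nth [::] [:: [:: 1; 1; 1];
                                     [:: 1; zeta; zeta ^+ 2];
                                     [:: 1; zeta ^+ 2; zeta]] i) j.

(* Main.v *)
Require Import Defs.
From mathcomp Require Import all_boot all_order all_algebra.
From mathcomp Require Import ring zify.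
From mathcomp Require Import reals complex.

Set Implicit Arguments.
Unset Strict Implicit.
Unset Printing Implicit Defensive.

Import GRing.Theory Num.Theory.
Local Open Scope ring_scope.

(** Write Q = S^2.  Since S is symmetric and unitary, S = Q conj(S), and the
    entries of Q are the integers N_{ij0}; so Q is an integral orthogonal
    matrix, and the positivity of the first column of S forces Q to be a
    permutation matrix fixing 0.  In rank 3 either Q = 1, so S is real and the
    algebra is symmetric, or Q swaps 1 and 2 and
      S = [[a, b, b], [b, d, conj d], [b, conj d, d]].
    In that case N_112 + N_111 = b / a and N_112 - N_111 = a / b are mutually
    inverse positive integers, so a = b, and d / b is a root of z^2 + z + 1. *)

Lemma big_ord3 (R : nmodType) (F : 'I_3 -> R) :
  \sum_(i < 3) F i = F 0 + F 1 + F 2.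
Proof.
rewrite !big_ord_recl big_ord0 addr0 addrA.
by congr (F _ + F _ + F _); apply: val_inj.
Qed.

Lemma ord3_ind (P : 'I_3 -> Prop) : P 0 -> P 1 -> P 2 -> forall i, P i.
Proof.
move=> P0 P1 P2 [[|[|[|//]]] lti].
- by have -> : Ordinal lti = 0 by apply: val_inj.
- by have -> : Ordinal lti = 1 by apply: val_inj.
- by have -> : Ordinal lti = 2 by apply: val_inj.
Qed.

(** The quadratic divides z^3 - 1, while z = 1 or z^2 = 1 would force 3 = 0. *)
Lemma primitive3_root (C : numFieldType) (z : C) :
  z ^+ 2 + z + 1 = 0 -> 3.-primitive_root z.
Proof.
move=> z2.
have three_neq0 : (3%:R : C) != 0 by rewrite pnatr_eq0.
(* The index i tests the exponent i + 1, so the three cases are the exponents 1, 2 and 3. *)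
apply/andP; split=> //; apply/forallP; elim/ord3_ind => /=.
- rewrite unity_rootE expr1; apply/eqP/negbTE/eqP => z1.
  by move/eqP: three_neq0; apply; rewrite -z2 z1; ring.
- rewrite unity_rootE; apply/eqP/negbTE/eqP => z1; move/eqP: three_neq0; apply.
  have zE : z = - 2%:R.
    transitivity (z ^+ 2 + z + 1 - z ^+ 2 - 1); first by ring.
    by rewrite z2 z1; ring.
  transitivity (z ^+ 2 - 1); first by rewrite zE; ring.
  by rewrite z1 subrr.
- rewrite unity_rootE; apply/eqP/eqP.
  have -> : z ^+ 3 = (z ^+ 2 + z + 1) * (z - 1) + 1 by ring.
  by rewrite z2 mul0r add0r.
Qed.

Lemma int_sqrD_eq1 (m n : int) : m ^+ 2 + n ^+ 2 = 1 ->
  m ^+ 2 = 1 /\ n = 0 \/ m = 0 /\ n ^+ 2 = 1.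
Proof.
move=> mn1; have : m = 0 \/ n = 0 by nia.
by case=> e; rewrite e in mn1 *; [right | left]; split=> //; lia.
Qed.

Lemma inv_int_pos_eq1 (F : numFieldType) (x : F) (m n : int) :
  0 < x -> x = m%:~R -> x^-1 = n%:~R -> x = 1.
Proof.
move=> x_gt0 xm xn; have m_gt0 : 0 < m by rewrite -(ltr0z F) -xm.
have n_gt0 : 0 < n by rewrite -(ltr0z F) -xn invr_gt0.
have mn : m * n = 1.
  by apply: (@intr_inj F); rewrite rmorphM /= -xm -xn divff ?lt0r_neq0.
by rewrite xm; have -> : m = 1 by nia.
Qed.

Section FourierSquare.
Variables (C : numClosedFieldType) (n : nat) (S : 'M[C]_n.+1).
Hypothesis fS : fourier_matrix S.

Lemma fourier_sym i j : S i j = S j i.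
Proof. by case: fS => _ symS _ _; rewrite -{1}symS mxE. Qed.

Lemma fourier_gt0 i : 0 < S i 0.
Proof. by case: fS. Qed.

Lemma fourier_conj0 i : (S i 0)^* = S i 0.
Proof. by apply/CrealP/gtr0_real/fourier_gt0. Qed.

Lemma fourier_dot i j : \sum_l S i l * (S j l)^* = (i == j)%:R.
Proof.
case: fS => /unitarymxP uS _ _ _.
move/matrixP/(_ i j): uS; rewrite !mxE => <-.
by apply: eq_bigr => l _; rewrite !mxE.
Qed.

(** For k = 0 the factor [(S l 0)^*] is real and cancels the denominator; this is how integrality
    reaches S^2. *)
Lemma fusion_coef0 i j : fusion_coef S i j 0 = (S *m S) i j.
Proof.
rewrite /fusion_coef mxE; apply: eq_bigr => l _.
by rewrite fourier_conj0 mulfK ?lt0r_neq0 ?fourier_gt0 // (fourier_sym i l).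
Qed.

Lemma fourier_sqr_int i j : exists m : int, (S *m S) i j = m%:~R.
Proof. by case: fS => _ _ _ intS; rewrite -fusion_coef0. Qed.

Lemma fourier_mulmx_conj : S *m map_mx Num.conj S = 1%:M.
Proof.
apply/matrixP => i j; rewrite !mxE -fourier_dot.
by apply: eq_bigr => l _; rewrite mxE (fourier_sym l j).
Qed.

Lemma fourier_sqr_conj : (S *m S) *m map_mx Num.conj S = S.
Proof. by rewrite -mulmxA fourier_mulmx_conj mulmx1. Qed.

Lemma fourier_sqr_sym i j : (S *m S) i j = (S *m S) j i.
Proof.
rewrite !mxE; apply: eq_bigr => l _.
by rewrite mulrC (fourier_sym l j) (fourier_sym i l).
Qed.

(** Column 0 of S is real, so this is the orthonormality of rows j and 0. *)
Lemma fourier_sqr0 j : (S *m S) j 0 = (j == 0)%:R.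
Proof.
rewrite mxE -fourier_dot; apply: eq_bigr => l _.
by rewrite (fourier_sym 0 l) fourier_conj0.
Qed.

(** Integers are fixed by conjugation, so one factor S^2 may be replaced by its conjugate; then S
    conj(S) = 1 cancels twice. *)
Lemma fourier_sqr_sqr : (S *m S) *m (S *m S) = 1%:M.
Proof.
have conjQ : map_mx Num.conj (S *m S) = S *m S.
  apply/matrixP => i j; rewrite mxE.
  by have [m ->] := fourier_sqr_int i j; rewrite rmorph_int.
by rewrite -{2}conjQ map_mxM mulmxA fourier_sqr_conj fourier_mulmx_conj.
Qed.

Lemma fourier_real_allen_symmetric : S *m S = 1%:M ->
  calg_symmetric (allen_calgebra (allen_of S)).
Proof.
move=> SS; have := fourier_sqr_conj; rewrite SS mul1mx => /matrixP conjS j.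
have {}conjS i k : (S i k)^* = S i k by rewrite -[RHS]conjS mxE.
by apply/matrixP => i k; rewrite !mxE !(rmorphM, fmorphV) /= !conjS.
Qed.

End FourierSquare.

Section Rank3.
Variables (C : numClosedFieldType) (S : 'M[C]_3).
Hypothesis fS : fourier_matrix S.

(** Away from index 0, S^2 is a symmetric integral 2 by 2 block with rows of norm 1, hence diagonal
    or antidiagonal with entries 1 or -1 there. *)
Lemma fourier3_sqr :
  S *m S = 1%:M \/ (S *m S) 1 1 = 0 /\ (S *m S) 1 2 = 1.
Proof.
have [m11 Q11] := fourier_sqr_int fS 1 1.
have [m12 Q12] := fourier_sqr_int fS 1 2.
have [m22 Q22] := fourier_sqr_int fS 2 2.
have Q10 := fourier_sqr0 fS 1; have Q20 := fourier_sqr0 fS 2.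
have Q21 : (S *m S) 2 1 = m12%:~R by rewrite (fourier_sqr_sym fS).
have /matrixP QQ := fourier_sqr_sqr fS.
have m1 : m11 ^+ 2 + m12 ^+ 2 = 1.
  apply: (@intr_inj C); move: (QQ 1 1).
  by rewrite mxE big_ord3 Q10 Q11 Q12 Q21 mul0r add0r mxE -!expr2 rmorphD !rmorphXn.
have m2 : m12 ^+ 2 + m22 ^+ 2 = 1.
  apply: (@intr_inj C); move: (QQ 2 2).
  by rewrite mxE big_ord3 Q20 Q22 Q12 Q21 mul0r add0r mxE -!expr2 rmorphD !rmorphXn.
(* Column 0 of this identity, where conjugation does nothing, relates positive numbers and so
   excludes the sign -1. *)
have /matrixP SE := fourier_sqr_conj fS.
have S1 : S 1 0 = m11%:~R * S 1 0 + m12%:~R * S 2 0.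
  move: (SE 1 0).
  by rewrite mxE big_ord3 Q10 Q11 Q12 mul0r add0r !mxE !(fourier_conj0 fS) => {1}<-.
have S2 : S 2 0 = m12%:~R * S 1 0 + m22%:~R * S 2 0.
  move: (SE 2 0).
  by rewrite mxE big_ord3 Q20 Q21 Q22 mul0r add0r !mxE !(fourier_conj0 fS) => {1}<-.
have pos_sign (m : int) (x y : C) : m ^+ 2 = 1 -> 0 < x -> 0 < y ->
    x = m%:~R * y -> m = 1.
  move=> m_1 x_gt0 y_gt0 xE.
  have : 0 < (m%:~R : C) by rewrite -(pmulr_lgt0 _ y_gt0) -xE.
  rewrite ltr0z; nia.
have S1_gt0 := fourier_gt0 fS 1; have S2_gt0 := fourier_gt0 fS 2.
case: (int_sqrD_eq1 m1) => [] [m11E m12E]; last first.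
  right; rewrite m11E mul0r add0r in S1.
  have m12_1 := pos_sign _ _ _ m12E S1_gt0 S2_gt0 S1.
  by rewrite Q11 Q12 m11E m12_1.
left; rewrite m12E in S1 S2 m2 Q12 Q21.
rewrite mul0r addr0 in S1; rewrite mul0r add0r in S2.
have m22E : m22 ^+ 2 = 1 by rewrite -m2 expr0n add0r.
have m11_1 := pos_sign _ _ _ m11E S1_gt0 S1_gt0 S1.
have m22_1 := pos_sign _ _ _ m22E S2_gt0 S2_gt0 S2.
apply/matrixP; elim/ord3_ind; elim/ord3_ind;
  rewrite [RHS]mxE ?(fourier_sqr_sym fS 0 _) ?(fourier_sqr0 fS) //.
- by rewrite Q11 m11_1.
- by rewrite Q22 m22_1.
Qed.

(** Row 1 of S^2 is the unit row at index 2, and S = S^2 conj(S). *)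
Lemma fourier3_swap :
  (S *m S) 1 1 = 0 -> (S *m S) 1 2 = 1 -> forall i, S 1 i = (S 2 i)^*.
Proof.
move=> Q11 Q12 i; have /matrixP/(_ 1 i) := fourier_sqr_conj fS.
by rewrite mxE big_ord3 (fourier_sqr0 fS) Q11 Q12 !mul0r mul1r !add0r mxE => <-.
Qed.

Lemma fourier3_swap_allen : (forall i, S 1 i = (S 2 i)^*) ->
  exists2 zeta : C, 3.-primitive_root zeta & allen_of S = cyclic3_table zeta.
Proof.
move=> swapS.
set a := S 0 0; set b := S 1 0; set d := S 1 1; set e := S 1 2.
have a_gt0 : 0 < a := fourier_gt0 fS 0; have b_gt0 : 0 < b := fourier_gt0 fS 1.
have a0 : a != 0 by apply: lt0r_neq0.
have b0 : b != 0 by apply: lt0r_neq0.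
have S20 : S 2 0 = b by rewrite -(fourier_conj0 fS) -swapS.
have S01 : S 0 1 = b by rewrite (fourier_sym fS).
have S02 : S 0 2 = b by rewrite (fourier_sym fS).
have S21 : S 2 1 = e by rewrite (fourier_sym fS).
have conj_e : e^* = d by rewrite -S21 -swapS.
have conj_d : d^* = e by rewrite -conj_e conjCK.
have S22 : S 2 2 = d by rewrite -conj_e [e]swapS conjCK.
have conj_a : a^* = a := fourier_conj0 fS 0.
have conj_b : b^* = b := fourier_conj0 fS 1.
have := fourier_dot fS 0 0; have := fourier_dot fS 0 1.
have := fourier_dot fS 1 1; have := fourier_dot fS 1 2.
rewrite !big_ord3 S01 S02 S20 S21 S22 -/a -/b -/d -/e.
rewrite conj_a conj_b conj_d conj_e /= ?mulr0n ?mulr1n => dot12 dot11 dot01 dot00.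
(* The orthogonality [dot01] reads b (a + d + e) = 0. *)
have eE : e = - a - d.
  by apply: (mulfI b0); apply/eqP; rewrite -subr_eq0 -dot01; apply/eqP; ring.
case: fS => _ _ _ intS.
have [n111] := intS 1 1 1; have [n112] := intS 1 1 2.
rewrite /fusion_coef !big_ord3 S01 S02 S20 S21 S22 -/a -/b -/d -/e.
rewrite conj_b conj_d conj_e => n112E n111E.
have deE : d + e = - a by rewrite eE; ring.
(* The terms in d and e add up to (d + e)(d^2 + e^2) / b, which is a b by [deE] and [dot12]; the
   norm [dot00] of row 0 then leaves b / a. *)
have ba : b / a = (n112 + n111)%:~R.
  rewrite rmorphD /= -n112E -n111E.
  transitivity (b * (a * a + b * b + b * b) / a); first by rewrite dot00 mulr1.
  transitivity (2 * b * b * b / a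
    + (d + e) * ((b * b + d * d + e * e) - b * b) / b); last by field; rewrite a0 b0.
  by rewrite deE dot12; field; rewrite a0 b0.
(* The terms b^3 / a cancel, leaving (d + e)(d - e)^2 / b, where (d - e)^2 = -1 by subtracting
   [dot11] from [dot12]. *)
have ab : a / b = (n112 - n111)%:~R.
  rewrite rmorphB /= -n112E -n111E.
  transitivity ((d + e) * ((b * b + d * d + e * e) - (b * b + d * e + e * d)) / b);
    last by field; rewrite a0 b0.
  by rewrite deE dot12 dot11; field.
have abE : a = b.
  apply/esym/divr1_eq; apply: (inv_int_pos_eq1 _ ba); rewrite ?divr_gt0 //.
  by rewrite invf_div ab.
(* With a = b, equating the norms of rows 0 and 1 gives d e = b^2; substituting e = -b - d yields
   the quadratic. *)
have d2 : d ^+ 2 + b * d + b ^+ 2 = 0.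
  have -> : d ^+ 2 + b * d + b ^+ 2 =
      ((a * a + b * b + b * b) - (b * b + d * e + e * d)) / 2.
    by rewrite eE abE; field.
  by rewrite dot00 dot11 subrr mul0r.
have zeta2 : (d / b) ^+ 2 + d / b + 1 = 0.
  transitivity ((d ^+ 2 + b * d + b ^+ 2) / b ^+ 2); first by field.
  by rewrite d2 mul0r.
have ebE : e / b = (d / b) ^+ 2.
  transitivity ((d / b) ^+ 2 - ((d / b) ^+ 2 + d / b + 1));
    last by rewrite zeta2 subr0.
  by rewrite eE abE; field.
(* The witness is the entry (1, 1) of [allen_of S]. *)
exists (d / b); first exact: primitive3_root.
by apply/matrixP; elim/ord3_ind; elim/ord3_ind;
  rewrite !mxE /= ?S01 ?S02 ?S20 ?S21 ?S22 -/a -/b -/d -/e ?ebE ?abE ?divff.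
Qed.

End Rank3.

Local Open Scope complex_scope.

Theorem theorem30 (R : realType) (s : 'M[R[i]]_3) :
  allen_matrix s ->
  ~ calg_symmetric (allen_calgebra s) ->
  exists2 zeta : R[i], 3.-primitive_root zeta & s = cyclic3_table zeta.
Proof.
move=> [S fS ->] asym.
have [SS | [Q11 Q12]] := fourier3_sqr fS.
  by case: asym; exact: fourier_real_allen_symmetric.
exact: (fourier3_swap_allen fS (fourier3_swap fS Q11 Q12)).
Qed.
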